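(* For each integer $n \ge 2$ and every $\epsilon > 0$ there exists a constant $C(n,\epsilon) > 0$ such that for every measurable set $A \subset \mathbb{H}^n$, $$\mathrm{Vol}(\mathrm{Conv}(A_\epsilon)) \le C(n,\epsilon)\,\mathrm{Vol}(A_\epsilon),$$ where $A_\epsilon = \bigcup_{x\in A} B_H(x,\epsilon)$.
   Context: $\mathbb{H}^n$ is the $n$-dimensional hyperbolic space (constant curvature $-1$), $\mathrm{Vol}$ is its Riemannian volume measure (possibly $+\infty$), $\mathrm{Conv}(X)$ is the smallest geodesically convex set containing $X$, and $B_H(x,\epsilon)$ is the ball of radius $\epsilon$ around $x$ with respect to the hyperbolic metric, so that $A_\epsilon$ is the $\epsilon$-extension of $A$ (for the open ball, the set of points at hyperbolic distance smaller than $\epsilon$ from $A$). *)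

(* Defs.v *)
From HB Require Import structures.
From mathcomp Require Import all_boot all_order all_algebra.
From mathcomp Require Import all_classical all_reals all_analysis.
From mathcomp Require Import measurable_realfun.

Set Implicit Arguments.
Unset Strict Implicit.
Unset Printing Implicit Defensive.
Import Order.TTheory GRing.Theory Num.Theory.
Import numFieldNormedType.Exports.

Local Open Scope classical_set_scope.
Local Open Scope ring_scope.

Section lebesgue_tuple.
Context {R : realType}.
Local Notation mR := (measurableTypeR R).

Definition pair_cons (n : nat) (p : mR * n.-tuple mR) : n.+1.-tuple mR :=
  [the n.+1.-tuple mR of p.1 :: p.2].

Lemma measurable_pair_cons n : measurable_fun setT (@pair_cons n).
Proof. exact: measurable_cons. Qed.

Section step.
Variables (n : nat) (mu : {sigma_finite_measure set (n.-tuple mR) -> \bar R}).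

Definition lebesgue_tuple_step : set (n.+1.-tuple mR) -> \bar R :=
  pushforward (@lebesgue_measure R \x mu)%E (@pair_cons n).

Let step0 : lebesgue_tuple_step set0 = 0%E.
Proof. by rewrite /lebesgue_tuple_step /pushforward preimage_set0 measure0. Qed.

Let step_ge0 A : (0 <= lebesgue_tuple_step A)%E.
Proof. by rewrite /lebesgue_tuple_step /pushforward measure_ge0. Qed.

Let step_sigma_additive : semi_sigma_additive lebesgue_tuple_step.
Proof.
have mP B : measurable B -> measurable (@pair_cons n @^-1` B).
  by move=> mB; rewrite -[X in measurable X]setTI; exact: measurable_pair_cons.
move=> F mF tF mUF; rewrite /lebesgue_tuple_step /pushforward preimage_bigcup.
apply: measure_semi_sigma_additive.
- by move=> i; exact: mP.
- apply/trivIsetP => i j _ _ ij; rewrite -preimage_setI.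
  by move/trivIsetP : tF => /(_ i j Logic.I Logic.I ij) ->; exact: preimage_set0.
- by rewrite -preimage_bigcup; exact: mP.
Qed.

HB.instance Definition _ := isMeasure.Build _ _ _ lebesgue_tuple_step
  step0 step_ge0 step_sigma_additive.

Let uncons (x : n.+1.-tuple mR) : mR * n.-tuple mR :=
  (tnth x ord0, [tuple of behead x]).

Let step_sigma_finite : sigma_finite setT lebesgue_tuple_step.
Proof.
have munc : measurable_fun setT uncons.
  by apply/measurable_fun_pairP; split;
    [exact: measurable_tnth | exact: measurable_behead].
have [F FT Foo] : sigma_finite setT (@lebesgue_measure R \x mu)%E.
  have /sigma_finiteP[F [TF ndF Foo]] := sigma_finiteT (@lebesgue_measure R).
  have /sigma_finiteP[G [TG ndG Goo]] := sigma_finiteT mu.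
  exists (fun k => F k `*` G k).
    rewrite -setXTT TF TG predeqE => -[x y]; split => [[/= [i _ Fx] [j _ Gy]]|].
      exists (maxn i j) => //; split.
      + by move: x Fx; exact/subsetPset/ndF/leq_maxl.
      + by move: y Gy; exact/subsetPset/ndG/leq_maxr.
    by move=> [k _ []/= ? ?]; split; exists k.
  move=> k; have [? ?] := Foo k; have [? ?] := Goo k.
  split; first exact: measurableX.
  by rewrite product_measure1E// lte_mul_pinfty// ge0_fin_numE.
exists (fun k => uncons @^-1` F k).
  by rewrite -preimage_bigcup -FT preimage_setT.
move=> k; have [mF Fk] := Foo k; split.
  by rewrite -[X in measurable X]setTI; exact: munc.
rewrite /lebesgue_tuple_step /pushforward -comp_preimage.
rewrite (_ : uncons \o _ = id) ?preimage_id//.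
by apply/funext => -[a t]; congr pair => //; exact/val_inj.
Qed.

HB.instance Definition _ := Measure_isSigmaFinite.Build _ _ _
  lebesgue_tuple_step step_sigma_finite.
End step.

(* Lebesgue measure on R^n, on the (product) Borel sigma-algebra of n-tuples *)
Fixpoint lebesgue_tuple (n : nat) :
    {sigma_finite_measure set (n.-tuple mR) -> \bar R} :=
  match n with
  | 0 => [the sigma_finite_measure _ _ of dirac ([tuple] : 0.-tuple mR)]
  | n'.+1 =>
    [the sigma_finite_measure _ _ of lebesgue_tuple_step (lebesgue_tuple n')]
  end.

End lebesgue_tuple.

(* The upper half-space model of hyperbolic n-space (n >= 1): a point is
   p = (x, y) with x in R^(n-1) and height y > 0, and the metric is
   (|dx|^2 + dy^2) / y^2. All sets live in the ambient R^(n-1) x R. *)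
Section upper_half_space.
Context {R : realType} (n : nat).
Local Notation mR := (measurableTypeR R).

Definition hpoint : measurableType _ := (n.-1.-tuple mR * mR)%type.
Implicit Types (p q : hpoint) (X S A : set hpoint).

Definition hspace : set hpoint := [set p | 0 < p.2].

Definition sqdist p q : R :=
  \sum_(i < n.-1) (tnth p.1 i - tnth q.1 i) ^+ 2 + (p.2 - q.2) ^+ 2.

Definition arcosh (t : R) : R := ln (t + Num.sqrt (t ^+ 2 - 1)).

Definition hdist p q : R := arcosh (1 + sqdist p q / (2 * p.2 * q.2)).

Definition hball p (e : R) : set hpoint :=
  [set q | hspace q /\ hdist p q < e].

Definition hextension A (e : R) : set hpoint := \bigcup_(x in A) hball x e.

(* g restricted to [0, l] is a unit-speed geodesic segment; in hyperbolic space
   every geodesic segment is minimizing. *)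
Definition hgeodesic (l : R) (g : R -> hpoint) : Prop :=
  forall s t, s \in `[0, l] -> t \in `[0, l] ->
    hspace (g s) /\ hdist (g s) (g t) = `|s - t|.

Definition geodesically_convex S : Prop :=
  S `<=` hspace /\
  forall l g, hgeodesic l g -> S (g 0) -> S (g l) -> g @` `[0, l] `<=` S.

Definition hconv X : set hpoint := smallest geodesically_convex X.

(* The Riemannian volume form of the metric above is dx dy / y^n. *)
Definition hvol A : \bar R :=
  (\int[lebesgue_tuple n.-1 \x @lebesgue_measure R]_(p in A `&` hspace)
     (p.2 ^- n)%:E)%E.

(* Membership in the sigma-algebra of the completed volume measure: a Borel set
   up to a subset of a Borel set of volume zero. *)
Definition hmeasurable A : Prop := A `<=` hspace /\ completed_algebra_gen hvol A.

End upper_half_space.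

(* Main.v *)
Require Import Defs.
From HB Require Import structures.
From mathcomp Require Import all_boot all_order all_algebra.
From mathcomp Require Import all_classical all_reals all_analysis.
From mathcomp Require Import measurable_realfun ring lra.

Import Order.TTheory GRing.Theory Num.Theory.
Import numFieldNormedType.Exports.
Local Open Scope classical_set_scope.
Local Open Scope ring_scope.

(* Let d = n - 1. A maximal family of k disjoint small boxes around points of A
   gives Vol(A_e) >= c k, and each point of A_e lies in the hyperbolic hull of
   infinity and a grid of boundedly many ideal points p in R^d attached to one
   of the k boxes. So it suffices to bound the volume of the hull of infinity
   and of m ideal points P by a constant times m.

   Let (a, h) be in that hull. Let r be the sup distance from a to P, attained
   at p0, and let R be the distance from a to the nearest point p1 of P outside
   the cone {2 v >= |.|}, where v is the signed coordinate realizing |p0 - a|. A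
   suitable hemisphere gives 4 h^2 >= r R, and R / 4 <= |p0 - p1| <= 2 R.
   Enumerate P farthest first and let delta_j be the distance of p_j to its
   predecessors. Then some p_j within O(R) of a has delta_j comparable to R,
   so that every (a, h) is charged to some j at scale delta_j. For fixed j and
   axis, the points a in a small cube with r comparable to 4^-m delta_j form a
   set of diameter O(4^-m delta_j), because their nearest points lie in each
   other's cones, and there h >= c 2^-m delta_j. The volume above this set is
   O(2^-m), and summing over m leaves a constant for each j. *)

(** * Lebesgue measure of cubes in [R^d] *)

Section boxes.
Context {R : realType}.
Local Notation mR := (measurableTypeR R).

Definition box (d : nat) (c : 'I_d -> R) (w : R) : set (d.-tuple mR) :=
  [set t | forall k, `|tnth t k - c k| <= w].

Lemma measurable_box (d : nat) (c : 'I_d -> R) (w : R) : measurable (box d c w).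
Proof.
have -> : box d c w = \bigcap_(k in [set: 'I_d])
    ((fun t : d.-tuple mR => tnth t k) @^-1` `[c k - w, c k + w]%classic).
  apply/seteqP; split=> [t Bt k _|t Bt k].
    by rewrite /preimage /= in_itv /= -ler_distl; exact: Bt.
  by have := Bt k Logic.I; rewrite /preimage /= in_itv /= -ler_distl.
apply: fin_bigcap_measurable => // k _.
rewrite -[X in measurable X]setTI; apply: (measurable_tnth k) => //.
Qed.

Lemma lebesgue_tuple_box (d : nat) (c : 'I_d -> R) (w : R) : 0 <= w ->
  lebesgue_tuple d (box d c w) = ((2 * w) ^+ d)%:E.
Proof.
move=> w0; elim: d c => [|d IHd] c.
  by rewrite expr0 /= diracE mem_set// => -[].
rewrite /= /lebesgue_tuple_step /pushforward.
have -> : @pair_cons R d @^-1` box d.+1 c w =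
    `[c ord0 - w, c ord0 + w]%classic `*` box d (fun k => c (lift ord0 k)) w.
  apply/seteqP; split=> [[x t] /= Bxt|[x t] /= [Bx Bt] k].
    split; first by rewrite in_itv /= -ler_distl; exact: (Bxt ord0).
    by move=> k; have := Bxt (lift ord0 k); rewrite tnthS.
  case: (unliftP ord0 k) => [j ->|->]; first by rewrite tnthS; exact: Bt.
  by move: Bx; rewrite in_itv /= -ler_distl.
rewrite product_measure1E//; last exact: measurable_box.
rewrite IHd.
rewrite [X in (X * _)%E](_ : _ = lebesgue_measure [set` `[c ord0 - w, c ord0 + w]]) // lebesgue_measure_itv /=.
rewrite lte_fin.
case: ltP => [_|]; last first.
  move=> h; have -> : w = 0 by lra.
  by rewrite mul0e mulr0 expr0n.
by rewrite -EFinD -EFinM; congr EFin; rewrite exprS; congr (_ * _); ring.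
Qed.

End boxes.

(** * Upper and lower bounds for hyperbolic volume *)

Section domination.
Context {R : realType} (d : nat).
Local Notation mR := (measurableTypeR R).
Local Notation pt := (@hpoint R d.+1).
Local Notation leb := (lebesgue_tuple d \x @lebesgue_measure R)%E.
Implicit Types (K : set pt) (v : R).

Let dens (p : pt) : \bar R := (p.2 ^- d.+1)%:E.

Let dens_ge0 (p : pt) : hspace p -> (0 <= dens p)%E.
Proof. by move=> p0; rewrite lee_fin invr_ge0 exprn_ge0 // ltW. Qed.

Import HBNNSimple.

(* No measurability is needed, since the integral of a non-negative function is a
   supremum over the simple functions below it. *)
Lemma le_nonmeasurable_integral dT (T : measurableType dT)
    (mu : {measure set T -> \bar R}) (f g : T -> \bar R) :
  (forall x, 0 <= f x)%E -> (forall x, f x <= g x)%E ->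
  (\int[mu]_x f x <= \int[mu]_x g x)%E.
Proof.
move=> f0 fg; rewrite !ge0_integralTE//; last by move=> x; exact: le_trans (fg x).
apply: le_ereal_sup => _ [h /= hf <-]; exists h => //= x.
exact: le_trans (fg x).
Qed.

Lemma hvolE K : hvol K = (\int[leb]_p (dens \_ (K `&` @hspace R d.+1)) p)%E.
Proof. by rewrite /hvol integral_mkcond. Qed.

Let dK_ge0 K p : (0 <= (dens \_ (K `&` @hspace R d.+1)) p)%E.
Proof. by apply: erestrict_ge0 => q [_]; exact: dens_ge0. Qed.

(** The pieces that cover the hull come without measurability. A measurable majorant of the density
    keeps upper bounds countably subadditive all the same. *)
Definition dominated K v := exists F : pt -> \bar R,
  [/\ measurable_fun setT F, (forall p, 0 <= F p)%E,
      (forall p, K p -> hspace p -> dens p <= F p)%E &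
      (\int[leb]_p F p <= v%:E)%E].

Lemma dominated_hvol K v : dominated K v -> (hvol K <= v%:E)%E.
Proof.
case=> F [mF F0 KF Fv]; rewrite hvolE; apply: le_trans Fv.
apply: le_nonmeasurable_integral => // p.
by rewrite patchE; case: ifPn => // ; rewrite inE => -[]; exact: KF.
Qed.

Lemma dominatedW K K' v v' : K `<=` K' -> v' <= v -> dominated K' v' ->
  dominated K v.
Proof.
move=> KK' vv' [F [mF F0 KF Fv]]; exists F; split=> //.
  by move=> p Kp; apply: KF; exact: KK'.
by apply: le_trans Fv _; rewrite lee_fin.
Qed.

Lemma dominated_set0 : dominated set0 0.
Proof.
by exists (cst 0%E); split=> //; rewrite integral0.
Qed.

Lemma dominated_bigcup_fin (I : finType) (K : I -> set pt) (v : I -> R) :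
  (forall i, dominated (K i) (v i)) ->
  dominated (\bigcup_i K i) (\sum_i v i).
Proof.
move=> /choice[F HF].
have mF i : measurable_fun setT (F i) by case: (HF i).
have F0 i p : (0 <= F i p)%E by case: (HF i).
exists (fun p => \sum_(i <- index_enum I) F i p)%E; split.
- exact: emeasurable_sum.
- by move=> p; exact: sume_ge0.
- move=> p [i _ Kp] hp; case: (HF i) => _ _ /(_ _ Kp hp) /le_trans + _.
  apply; rewrite (bigD1 i)//= leeDl//; exact: sume_ge0.
- rewrite ge0_integral_sum// -sumEFin; apply: lee_sum => i _.
  by case: (HF i).
Qed.

Lemma dominated_bigcup_geo (K : nat -> set pt) v :
  (forall i, dominated (K i) (v / (2 ^ i)%:R)) ->
  dominated (\bigcup_i K i) (2 * v).
Proof.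
move=> /choice[F HF].
have mF i : measurable_fun setT (F i) by case: (HF i).
have F0 i p : (0 <= F i p)%E by case: (HF i).
exists (fun p => \sum_(i <oo) F i p)%E; split.
- exact: ge0_emeasurable_sum.
- by move=> p; exact: nneseries_ge0.
- move=> p [i _ Kp] hp; case: (HF i) => _ _ /(_ _ Kp hp) /le_trans + _.
  apply; rewrite (@nneseriesD1 _ (F ^~ p) i xpredT)//= leeDl//; exact: nneseries_ge0.
- rewrite integral_nneseries//.
  apply: (@le_trans _ _ (\sum_(i <oo) (v / (2 ^ i)%:R)%:E)%E).
    apply: lee_nneseries => i *; last by case: (HF i).
    exact: integral_ge0.
  rewrite (@eq_eseriesr R _ (fun i => (2 * v / (2 ^ (i + 1))%:R)%:E) xpredT).
    by rewrite (cvg_lim _ (@cvg_geometric_eseries_half R (2 * v) 0))// expr0 divr1.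
  move=> i _; congr EFin; rewrite addn1 expnS natrM invfM.
  by rewrite [2 * v]mulrC -mulrA; congr (_ * _); rewrite mulrA mulfV ?mul1r.
Qed.

Lemma leb_slab (c : 'I_d -> R) (w a b : R) : 0 <= w -> a <= b ->
  leb (box d c w `*` `[a, b]%classic) = ((2 * w) ^+ d * (b - a))%:E.
Proof.
move=> w0 ab.
transitivity (lebesgue_tuple d (box d c w) * @lebesgue_measure R [set` `[a, b]])%E.
  by apply: product_measure1E => //; exact: measurable_box.
rewrite lebesgue_tuple_box// lebesgue_measure_itv /= lte_fin.
case: ltP => [_|ba]; first by rewrite -EFinD -EFinM.
by rewrite mule0 (_ : b - a = 0) ?mulr0//; lra.
Qed.

Lemma dominated_slab (c : 'I_d -> R) (w h : R) : 0 <= w -> 0 < h ->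
  dominated [set p | box d c w p.1 /\ h <= p.2 <= 2 * h]
    ((2 * w / h) ^+ d).
Proof.
move=> w0 h0; pose E : set pt := box d c w `*` `[h, 2 * h]%classic.
have mE : measurable E by apply: measurableX => //; exact: measurable_box.
exists (fun p => (h ^- d.+1)%:E * (\1_E p)%:E)%E; split.
- apply: emeasurable_funM; first exact: measurable_cst.
  by apply/measurable_EFinP; exact: measurable_indic.
- by move=> p; rewrite -EFinM lee_fin mulr_ge0// invr_ge0 exprn_ge0 // ltW.
- move=> p [Bp /andP[hp1 hp2]] hp; rewrite indicE mem_set/=; last first.
    by split=> //=; rewrite in_itv /= hp1 hp2.
  rewrite mule1 lee_fin lef_pV2 ?posrE ?exprn_gt0//.
  by rewrite lerXn2r // nnegrE ltW.
- rewrite ge0_integralZl//; [|by apply/measurable_EFinP; exact: measurable_indic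
    |by rewrite lee_fin invr_ge0 exprn_ge0 // ltW].
  have hh : h <= 2 * h by lra.
  rewrite integral_indic// setIT [X in (_ * X)%E](leb_slab c w h (2 * h) w0 hh).
  rewrite -!EFinM lee_fin expr_div_n exprS invfM.
  rewrite [leLHS](_ : _ = (2 * w) ^+ d * h ^- d * (h^-1 * h)); last by ring.
  by rewrite mulVf ?mulr1// gt_eqF.
Qed.

Lemma geometric_scale (b : nat) (x : R) : (1 < b)%N -> 1 <= x ->
  exists i, (b ^ i)%:R <= x < (b ^ i.+1)%:R.
Proof.
move=> b1 x1; have x0 : 0 <= x by lra.
have n1 : (0 < Num.truncn x)%N by rewrite truncn_gt0.
have /andP[e1 e2] := trunc_log_bounds b1 n1.
have /andP[t1 t2] := truncn_itv x0.
exists (trunc_log b (Num.truncn x)); apply/andP; split.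
  by apply: le_trans t1; rewrite ler_nat.
by apply: (lt_le_trans t2); rewrite ler_nat.
Qed.

(** Cut the column into slabs between heights [2^i h] and [2^(i+1) h]. Their bounds decay like
    [2^(-i d)], which is at most [2^-i] because [d > 0]. *)
Lemma dominated_column (c : 'I_d -> R) (w h : R) : (0 < d)%N -> 0 <= w -> 0 < h ->
  dominated [set p | box d c w p.1 /\ h <= p.2] (2 * (2 * w / h) ^+ d).
Proof.
move=> d0 w0 h0.
have pow_gt0 i : 0 < (2 ^ i)%:R :> R by rewrite ltr0n expn_gt0.
apply: dominatedW (@dominated_bigcup_geo
    (fun i => [set p | box d c w p.1 /\ (2 ^ i)%:R * h <= p.2 <= 2 * ((2 ^ i)%:R * h)])
    ((2 * w / h) ^+ d) _); [|by []|] => [p [Bp hp]|i].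
  have /(@geometric_scale 2)-/(_ isT)[i /andP[i1 i2]] : 1 <= p.2 / h.
    by rewrite ler_pdivlMr ?mul1r.
  exists i => //; split=> //; rewrite -ler_pdivlMr// i1 /= mulrA -ler_pdivrMr//.
  by rewrite -natrM -expnS ltW.
apply: dominatedW (@dominated_slab c w ((2 ^ i)%:R * h) w0 _) => //.
  rewrite invfM mulrCA mulrC exprMn ler_wpM2l ?exprn_ge0 ?divr_ge0 ?mulr_ge0 ?(ltW h0)//.
  rewrite exprVn lef_pV2 ?posrE ?exprn_gt0//.
  by apply: ler_eXnr; rewrite ?ler1n ?expn_gt0.
exact: mulr_gt0.
Qed.

(** Sides proportional to the height of [p] make this a stand-in for a ball of fixed hyperbolic
    size. *)
Definition hbox (kappa : R) (p : pt) : set pt :=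
  [set q | box d (tnth p.1) (kappa * p.2) q.1 /\ p.2 <= q.2 <= (1 + kappa) * p.2].

(** On each box the density is at least its value at the top, which contributes an amount depending
    on [kappa] and [d] only. Disjointness keeps the sum of these step functions below the
    density. *)
Lemma hvol_disjoint_hboxes (kappa : R) (k : nat) (x : 'I_k -> pt) (A : set pt) :
  0 < kappa -> (forall i, hspace (x i)) ->
  (forall i j, i != j -> hbox kappa (x i) `&` hbox kappa (x j) = set0) ->
  (forall i, hbox kappa (x i) `<=` A) ->
  ((k%:R * ((2 * kappa / (1 + kappa)) ^+ d * (kappa / (1 + kappa))))%:E <= hvol A)%E.
Proof.
move=> k0 hx dis sub.
pose E i : set pt := box d (tnth (x i).1) (kappa * (x i).2) `*`
  `[(x i).2, (1 + kappa) * (x i).2]%classic.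
have mE i : measurable (E i) by apply: measurableX => //; exact: measurable_box.
have EE i p : E i p <-> hbox kappa (x i) p.
  by split=> -[Bp /=]; rewrite ?in_itv => ?; split=> //=; rewrite in_itv.
pose c i := ((1 + kappa) * (x i).2) ^- d.+1.
have kx i : 0 < (1 + kappa) * (x i).2 by apply: mulr_gt0; [lra|exact: hx].
have c0 i : 0 <= c i by rewrite invr_ge0 exprn_ge0 // ltW.
have mind i : measurable_fun setT (fun p => (c i)%:E * (\1_(E i) p)%:E)%E.
  apply: emeasurable_funM; first exact: measurable_cst.
  by apply/measurable_EFinP; exact: measurable_indic.
rewrite hvolE.
apply: (@le_trans _ _ (\int[leb]_p \sum_(i <- index_enum 'I_k) ((c i)%:E * (\1_(E i) p)%:E))%E).
  rewrite ge0_integral_sum//; last by move=> i p _; rewrite -EFinM lee_fin mulr_ge0.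
  rewrite (eq_bigr (fun=> ((2 * kappa / (1 + kappa)) ^+ d * (kappa / (1 + kappa)))%:E)).
    by rewrite sumEFin sumr_const card_ord mulr_natl.
  move=> i _; rewrite ge0_integralZl//; [|by apply/measurable_EFinP; exact: measurable_indic
    |by rewrite lee_fin].
  have xi0 : 0 < (x i).2 by exact: hx.
  have w0 : 0 <= kappa * (x i).2 by rewrite mulr_ge0 ?(ltW k0) ?(ltW xi0).
  have hh : (x i).2 <= (1 + kappa) * (x i).2 by nra.
  rewrite integral_indic// setIT [X in (_ * X)%E](leb_slab _ _ _ _ w0 hh).
  rewrite -!EFinM; congr EFin; rewrite /c exprS !expr_div_n !exprMn; field.
  by rewrite ?mulf_neq0 ?expf_neq0 ?gt_eqF//; lra.
apply: le_nonmeasurable_integral => p.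
  by apply: sume_ge0 => i _; rewrite -EFinM lee_fin mulr_ge0.
have [[i Ei]|nE] := pselect (exists i, E i p); last first.
  rewrite big1 ?dK_ge0// => i _; rewrite indicE memNset ?mule0// => Ei.
  by apply: nE; exists i.
rewrite (bigD1 i)//= big1 ?adde0; last first.
  move=> j ji; rewrite indicE memNset ?mule0// => Ej.
  by have := dis _ _ ji; rewrite -subset0 => /(_ p); apply; split; apply/EE.
have /EE[Bp /andP[p1 p2]] := Ei.
have p0 : 0 < p.2 by apply: lt_le_trans p1; exact: hx.
rewrite indicE mem_set// mule1 patchE ifT; last first.
  by rewrite inE; split=> //; apply: (sub i); apply/EE.
rewrite lee_fin lef_pV2 ?posrE ?exprn_gt0//.
by rewrite lerXn2r // nnegrE ltW.
Qed.
End domination.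

(** * Half-spaces, balls and boxes in the upper half-space model *)

Section hyperbolic_geometry.
Context {R : realType} (d : nat).
Local Notation pt := (@hpoint R d.+1).
Local Notation hspace := (@hspace R d.+1).
Implicit Types (p q m : pt) (c : 'I_d -> R) (X : set pt).

Definition coshdist p q : R := 1 + sqdist p q / (2 * p.2 * q.2).

Lemma sqdist_ge0 p q : 0 <= sqdist p q.
Proof. by rewrite addr_ge0 ?sqr_ge0// sumr_ge0// => k _; exact: sqr_ge0. Qed.

Lemma coshdist_ge1 p q : hspace p -> hspace q -> 1 <= coshdist p q.
Proof.
move=> p0 q0; rewrite lerDl divr_ge0 ?sqdist_ge0// ltW//.
by rewrite !mulr_gt0.
Qed.

Lemma expR_arcosh (t : R) : 1 <= t -> expR (arcosh t) = t + Num.sqrt (t ^+ 2 - 1).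
Proof. by move=> t1; rewrite lnK// posrE ltr_wpDr ?sqrtr_ge0//; lra. Qed.

Lemma cosh_arcosh (t : R) : 1 <= t ->
  t = (expR (arcosh t) + (expR (arcosh t))^-1) / 2.
Proof.
move=> t1; rewrite expR_arcosh//; set q := Num.sqrt _.
have q0 : 0 <= q by exact: sqrtr_ge0.
have q2 : q ^+ 2 = t ^+ 2 - 1 by rewrite sqr_sqrtr//; nra.
have -> : (t + q)^-1 = t - q.
  have tq : t + q != 0 by rewrite gt_eqF//; lra.
  by apply: (mulfI tq); rewrite mulfV//; lra.
by lra.
Qed.

Lemma sum_sqrB c c' :
  \sum_k (c k - c' k) ^+ 2 =
  \sum_k c k * c k - 2 * (\sum_k c k * c' k) + \sum_k c' k * c' k.
Proof.
rewrite mulr_sumr -sumrB -big_split /=; apply: eq_bigr => k _; ring.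
Qed.

Lemma coshdistE p q : hspace p -> hspace q ->
  \sum_k (tnth p.1 k - tnth q.1 k) ^+ 2 + p.2 ^+ 2 + q.2 ^+ 2 =
  2 * coshdist p q * p.2 * q.2.
Proof.
rewrite /coshdist /sqdist /= => p0 q0; field.
by rewrite !gt_eqF.
Qed.

(** For [s > 0], the condition [s <= hsum c x h] describes the hyperbolic half-space outside the
    hemisphere of squared radius [s] about [c]. *)
Let hsum c (x : 'I_d -> R) (h : R) := \sum_k (x k - c k) ^+ 2 + h ^+ 2.

(** In the hyperboloid model let [X], [Y], [Z] be the three points and [V = a hx X + b hz Z]. The
    hypotheses read [<V, Y> = <V, V> = -1], so [V - Y] is null and orthogonal to the timelike [Y],
    hence zero. *)
Lemma halfspace_combination (a b hx hy hz s : R) (x y z c : 'I_d -> R) :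
  0 <= a -> 0 <= b ->
  a * (\sum_k (x k - y k) ^+ 2 + hx ^+ 2 + hy ^+ 2) +
    b * (\sum_k (y k - z k) ^+ 2 + hy ^+ 2 + hz ^+ 2) = 2 * hy ->
  a ^+ 2 * hx ^+ 2 + b ^+ 2 * hz ^+ 2 +
    a * b * (\sum_k (x k - z k) ^+ 2 + hx ^+ 2 + hz ^+ 2) = 1 ->
  s <= hsum c x hx -> s <= hsum c z hz -> s <= hsum c y hy.
Proof.
move=> a0 b0; rewrite /hsum !sum_sqrB.
pose dot (u v : 'I_d -> R) := \sum_k u k * v k.
rewrite -![\sum_k _ k * _ k]/(dot _ _) => I2 I1 sx sz.
pose e k := (a + b) * y k - a * x k - b * z k.
have dote v : dot e v = (a + b) * dot y v - a * dot x v - b * dot z v.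
  by rewrite /dot !mulr_sumr -!sumrB; apply: eq_bigr => k _; rewrite /e; ring.
have dotC u v : dot u v = dot v u by apply: eq_bigr => k _; rewrite mulrC.
(* Both hypotheses together turn into this vanishing sum of squares, so every [e k] is zero and
   [(a + b) * hy = 1]. *)
have ee : dot e e + ((a + b) * hy - 1) ^+ 2 = 0.
  rewrite dote !(dotC _ e) !dote (dotC z x) (dotC y x) (dotC z y).
  move: I1 I2; move: (dot _ _) (dot _ _) (dot _ _) (dot _ _) (dot _ _) (dot _ _).
  by move=> *; nra.
have e0 k : e k = 0.
  have := sqr_ge0 ((a + b) * hy - 1) => h1.
  have ek : e k * e k <= dot e e.
    rewrite /dot (bigD1 k)//= lerDl sumr_ge0// => j _.
    by rewrite -expr2 sqr_ge0.
  by apply/eqP; rewrite -sqrf_eq0 eq_le sqr_ge0 andbT expr2; lra.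
have dote0 v : dot e v = 0 by rewrite /dot big1// => k _; rewrite e0 mul0r.
have u1 : (a + b) * hy = 1.
  by move: ee; rewrite dote0 add0r => /eqP; rewrite sqrf_eq0 subr_eq0 => /eqP.
have := dote c; have := dote y; rewrite !dote0 (dotC z y) => Dy Dc.
rewrite -subr_ge0 in sx; rewrite -subr_ge0 in sz.
have Hx := mulr_ge0 a0 sx; have Hz := mulr_ge0 b0 sz.
have ab0 : 0 < a + b.
  rewrite lt_neqAle addr_ge0// andbT eq_sym; apply/eqP => ab0.
  by move: u1; rewrite ab0 mul0r => /eqP; rewrite eq_sym oner_eq0.
have hy2 : (a + b) * hy ^+ 2 = hy by rewrite expr2 mulrA u1 mul1r.
rewrite -(ler_pM2l ab0); move: I2 u1 hy2 Hx Hz Dy Dc; clear.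
move: (dot x x) (dot x y) (dot y y) (dot y z) (dot z z) (dot y c) (dot x c) (dot z c) (dot c c).
by move=> *; lra.
Qed.

(* In the hyperboloid model, [m] is the combination of [p] and [q] with
   non-negative coefficients sinh(b)/sinh(a+b) and sinh(a)/sinh(a+b), where
   [A = exp a] and [B = exp b]; half-spaces are given there by linear
   inequalities. *)
Lemma halfspace_between (A B s : R) c p m q:
  hspace p -> hspace m -> hspace q -> 1 <= A -> 1 <= B -> 1 < A * B ->
  coshdist p m = (A + A^-1) / 2 -> coshdist m q = (B + B^-1) / 2 ->
  coshdist p q = (A * B + (A * B)^-1) / 2 ->
  s <= hsum c (tnth p.1) p.2 -> s <= hsum c (tnth q.1) q.2 ->
  s <= hsum c (tnth m.1) m.2.
Proof.
move=> hp hm hq A1 B1 AB1 cpm cmq cpq.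
have p0 : 0 < p.2 := hp. have m0 : 0 < m.2 := hm. have q0 : 0 < q.2 := hq.
pose la := (B - B^-1) / (A * B - (A * B)^-1).
pose mu := (A - A^-1) / (A * B - (A * B)^-1).
have A0 : 0 < A by lra.
have B0 : 0 < B by lra.
have inv_le1 (x : R) : 1 <= x -> x^-1 <= 1 by move=> x1; rewrite invf_le1//; lra.
have AB0 : 0 < A * B - (A * B)^-1.
  by have := inv_le1 _ (ltW AB1); lra.
have la0 : 0 <= la by apply: divr_ge0; [have := inv_le1 _ B1; lra|exact: ltW].
have mu0 : 0 <= mu by apply: divr_ge0; [have := inv_le1 _ A1; lra|exact: ltW].
have An0 : A != 0 by rewrite gt_eqF.
have Bn0 : B != 0 by rewrite gt_eqF.
have ABn0 : (A * B) ^+ 2 - 1 != 0.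
  by rewrite gt_eqF// subr_gt0 -[1](expr1n _ 2) ltrXn2r ?nnegrE//; lra.
have I1 : la ^+ 2 + mu ^+ 2 + la * mu * (A * B + (A * B)^-1) = 1.
  rewrite /la /mu; field.
  by rewrite An0 Bn0 /= -expr2.
have I2 : la * (A + A^-1) + mu * (B + B^-1) = 2.
  rewrite /la /mu; field.
  by rewrite An0 Bn0 /= -expr2.
apply: (@halfspace_combination (la / p.2) (mu / q.2)).
- by rewrite divr_ge0// ltW.
- by rewrite divr_ge0// ltW.
- rewrite !coshdistE// cpm cmq -[2 in RHS]I2; field.
  by rewrite ?mulf_neq0 ?gt_eqF.
- rewrite coshdistE// cpq -[1 in RHS]I1; field.
  by rewrite ?mulf_neq0 ?gt_eqF.
Qed.

Lemma halfspace_convex c (s : R) :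
  geodesically_convex [set p : pt | hspace p /\ s <= hsum c (tnth p.1) p.2].
Proof.
split=> [p []//|l g geo [h0 s0] [hl sl] _ [t /= tl <-]].
have l0 : 0 <= l by move: tl; rewrite in_itv /= => /andP[]; exact: le_trans.
have m0 : 0 \in `[0, l] by rewrite in_itv /= lexx l0.
have ml : l \in `[0, l] by rewrite in_itv /= lexx l0.
have [ht] := geo _ _ tl tl.
(* Length zero is set apart, since [halfspace_between] divides by [sinh l]. *)
split=> //; move: l0; rewrite le_eqVlt => /predU1P[l0|l0].
  have -> : t = 0.
    by move: tl; rewrite -l0 in_itv /= => /andP[*]; apply/eqP; rewrite eq_le; apply/andP.
  by [].
move: tl (tl); rewrite {1}in_itv /= => /andP[t0 tl] tml.
have E u v : u \in `[0, l] -> v \in `[0, l] -> u <= v ->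
    coshdist (g u) (g v) = (expR (v - u) + (expR (v - u))^-1) / 2.
  move=> ui vi uv; have [hu duv] := geo _ _ ui vi; have [hv _] := geo _ _ vi ui.
  rewrite [LHS]cosh_arcosh ?coshdist_ge1// -/(hdist _ _) duv.
  by rewrite distrC ger0_norm// subr_ge0.
apply: (@halfspace_between (expR (t - 0)) (expR (l - t)) s c (g 0) (g t) (g l)) => //.
- by rewrite subr0 -expR0 ler_expR.
- by rewrite -expR0 ler_expR subr_ge0.
- by rewrite -expRD addrC subrKA subr0 -expR0 ltr_expR.
- exact: E.
- exact: E.
- by rewrite -expRD (addrC (t - 0)) subrKA E// ltW.
Qed.

Lemma hconv_halfspace X c (s : R) : X `<=` hspace ->
  (forall p, X p -> s <= hsum c (tnth p.1) p.2) ->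
  forall p, hconv X p -> hspace p /\ s <= hsum c (tnth p.1) p.2.
Proof.
move=> Xh Xs p Kp; apply: (Kp [set p | hspace p /\ s <= hsum c (tnth p.1) p.2]).
by split; [exact: halfspace_convex|move=> q Xq; split; [exact: Xh|exact: Xs]].
Qed.

(** The [cosh] of the distance is below [expR e], so [coshdistE] bounds a sum of squares by
    [2 * expR e * p.2 * q.2], which makes all these lengths comparable. *)
Lemma hball_bounds p q (e : R) (M := 2 + 2 * expR e) : 0 < e -> hspace p -> hball p e q ->
  [/\ (forall k, `|tnth q.1 k - tnth p.1 k| <= M * p.2), p.2 <= M * q.2 & 0 < q.2].
Proof.
move=> e0 hp [hq dpq].
have p0 : 0 < p.2 := hp. have q0 : 0 < q.2 := hq.
have e1 : 1 <= expR e by rewrite -expR0 ler_expR ltW.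
have T1 := coshdist_ge1 _ _ hp hq.
have Te : coshdist p q < expR e.
  apply: (@le_lt_trans _ _ (expR (hdist p q))); last by rewrite ltr_expR.
  by rewrite expR_arcosh// lerDl sqrtr_ge0.
have := coshdistE _ _ hp hq.
set S := \sum_k _ => E.
have S0 : 0 <= S by rewrite sumr_ge0// => k _; exact: sqr_ge0.
have pq0 : 0 < p.2 * q.2 by exact: mulr_gt0.
have bd : S + p.2 ^+ 2 + q.2 ^+ 2 < 2 * expR e * (p.2 * q.2).
  by rewrite E -!mulrA ltr_pM2l// ltr_pM2r.
have qp : q.2 <= 2 * expR e * p.2.
  have : q.2 * q.2 <= 2 * expR e * p.2 * q.2 by nra.
  by rewrite ler_pM2r.
have pq : p.2 <= 2 * expR e * q.2.
  have : p.2 * p.2 <= 2 * expR e * q.2 * p.2 by nra.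
  by rewrite ler_pM2r.
split=> //; last by rewrite /M; nra.
move=> k.
have Sk : (tnth q.1 k - tnth p.1 k) ^+ 2 <= S.
  rewrite /S (bigD1 k)//= -sqrrN opprB lerDl sumr_ge0// => j _.
  exact: sqr_ge0.
have M0 : 0 <= M * p.2 by rewrite /M; nra.
rewrite -(ler_pXn2r (ltn0Sn 1)) ?nnegrE// ?normr_ge0// real_normK ?num_real//.
apply: (le_trans Sk).
have : 2 * expR e * (p.2 * q.2) <= (2 * expR e * p.2) ^+ 2.
  rewrite mulrA expr2 ler_wpM2l//; nra.
rewrite /M; set Ee := expR e in e1 *; move: bd; rewrite -/Ee; clearbody Ee S.
move=> bd b2; nra.
Qed.

(** The [d.+1] coordinates add up to at most [eta^2 p.2^2] in [sqdist], so
    [coshdist p q <= 1 + eta^2] and [expR (hdist p q) <= 1 + eta^2 + 2 eta <= 1 + e < expR e]. *)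
Lemma hbox_hball (e : R) (eta := Num.min 1 (e / 3)) (kappa := eta / d.+1%:R) p :
  0 < e -> hspace p -> hbox d kappa p `<=` hball p e.
Proof.
move=> e0 hp q [Bq /andP[q1 q2]].
have p0 : 0 < p.2 := hp.
have q0 : 0 < q.2 by exact: lt_le_trans q1.
split=> //; rewrite -ltr_expR.
have T1 := coshdist_ge1 p q hp q0.
rewrite expR_arcosh//.
have eta0 : 0 < eta by rewrite lt_min ltr01 divr_gt0.
have eta1 : eta <= 1 by rewrite ge_min lexx.
have etae : 3 * eta <= e.
  have : eta <= e / 3 by rewrite ge_min lexx orbT.
  by lra.
have kap0 : 0 < kappa by rewrite divr_gt0.
have T2 : coshdist p q <= 1 + eta ^+ 2.
  rewrite lerD2l ler_pdivrMr ?mulr_gt0//.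
  apply: (@le_trans _ _ (eta ^+ 2 * p.2 ^+ 2)); last first.
    rewrite -[2 * p.2 * q.2]mulrA ler_wpM2l ?sqr_ge0//; nra.
  apply: (@le_trans _ _ (d.+1%:R * (kappa * p.2) ^+ 2)).
    rewrite mulr_natl mulrSr lerD//; last first.
      by rewrite -sqrrN opprB lerXn2r ?nnegrE//; nra.
    rewrite -[X in _ *+ X](card_ord d) -sumr_const; apply: ler_sum => k _.
    rewrite -(real_normK (num_real _)) distrC lerXn2r ?nnegrE// ?Bq//.
    by rewrite mulr_ge0// ltW.
  rewrite exprMn mulrA ler_wpM2r ?sqr_ge0// /kappa expr_div_n.
  rewrite mulrCA ler_piMr ?sqr_ge0// expr2 invfM mulrA mulfV ?mul1r ?pnatr_eq0//.
  by rewrite invf_le1 ?ler1n.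
apply: (@le_lt_trans _ _ (1 + e)); last by rewrite expR_gt1Dx// gt_eqF.
set t := coshdist p q in T1 T2 *.
have : Num.sqrt (t ^+ 2 - 1) <= 2 * eta.
  have e2 : 0 <= 2 * eta by lra.
  rewrite -(ler_pXn2r (ltn0Sn 1)) ?nnegrE ?sqrtr_ge0// sqr_sqrtr; last by nra.
  have x1 : eta ^+ 2 <= 1 by rewrite expr_le1// ltW.
  have : (t - 1) * (t + 1) <= eta ^+ 2 * 3 by apply: ler_pM; lra.
  by have := sqr_ge0 eta; lra.
have h2 : eta ^+ 2 <= eta by rewrite expr2 ler_piMr// ltW.
move=> h1; apply: (le_trans (lerD T2 h1)); move: h2 etae; clearbody eta; clear.
by lra.
Qed.
End hyperbolic_geometry.

(** * Farthest-first enumeration of a finite set *)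

Section greedy_net.
Context {R : realType} (I : finType) (D : I -> I -> R) (M : R).
Hypothesis D_ge0 : forall i j, 0 <= D i j.
Hypothesis D_leM : forall i j, D i j <= M.
Hypothesis D_refl : forall i, D i i = 0.
Hypothesis D_sym : forall i j, D i j = D j i.

Lemma farthest_point (Q : {set I}) : Q != finset.set0 -> Q != [set: I]%SET ->
  exists x t, [/\ x \notin Q, 0 <= t, (forall q, q \in Q -> t <= D x q) &
    forall i, exists2 q, q \in Q & D i q <= t].
Proof.
move=> /set0Pn[q0 q0Q] QT.
have [x0 x0Q] : exists x, x \in ~: Q.
  by apply/set0Pn; apply: contraNneq QT => C0; rewrite -(finset.setCK Q) C0 finset.setC0.
pose f i := D i [arg min_(q < q0 in Q) D i q]%O.
have fP i : (exists2 q, q \in Q & D i q <= f i) /\ forall q, q \in Q -> f i <= D i q.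
  by rewrite /f; case: arg_minP => // q qQ qmin; split=> //; exists q.
case: (@arg_maxP _ _ _ x0 (mem (~: Q)) f x0Q) => x xQ xmax.
exists x, (f x); split.
- by have : x \in ~: Q := xQ; rewrite finset.in_setC.
- exact: D_ge0.
- exact: (fP x).2.
- move=> i; case: (boolP (i \in Q)) => iQ.
    by exists i => //; rewrite D_refl; exact: D_ge0.
  have [[q qQ qi] _] := fP i; exists q => //; apply: le_trans qi _.
  by apply: xmax; rewrite -[_ i]/(i \in ~: Q) finset.in_setC.
Qed.

(* [delta j] is the distance of [j] to the points chosen before it when points
   are enumerated farthest first. *)
Lemma greedy_net (i0 : I) : exists delta : I -> R,
  (forall i j, i != j -> Num.min (delta i) (delta j) <= D i j) /\
  (forall s, 0 <= s <= M -> forall i, exists2 j, s <= delta j & D i j <= s).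
Proof.
(* Induction on the number of points not yet chosen: the chosen set [Q] is separated with respect to
   [delta] and covers everything at each scale in [[t, M]], where [t] bounds [delta] from below on
   [Q]. *)
suff build n (Q : {set I}) (delta : I -> R) (t : R) : #|~: Q| = n -> Q != finset.set0 ->
    (forall i, i \in Q -> t <= delta i) ->
    (forall i j, i \in Q -> j \in Q -> i != j -> Num.min (delta i) (delta j) <= D i j) ->
    (forall s, t <= s <= M -> forall i, exists j, [/\ j \in Q, s <= delta j & D i j <= s]) ->
    t <= M ->
    exists delta : I -> R,
      (forall i j, i != j -> Num.min (delta i) (delta j) <= D i j) /\
      (forall s, 0 <= s <= M -> forall i, exists2 j, s <= delta j & D i j <= s).
  (* The first point has no predecessors; it gets [M], which bounds all distances. *)
  apply: (build _ [set i0]%SET (fun=> M) M erefl).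
  - by apply/set0Pn; exists i0; rewrite finset.set11.
  - by [].
  - by move=> i j; rewrite !finset.in_set1 => /eqP-> /eqP->; rewrite eqxx.
  - move=> s /andP[s1 s2] i; exists i0; rewrite finset.set11; split=> //.
    exact: le_trans (D_leM _ _) s1.
  - by [].
elim: n Q delta t => [|n IHn] Q delta t cQ Q0 tQ sepQ netQ tM.
  have QT i : i \in Q.
    by move/eqP: cQ; rewrite cards_eq0 => /eqP/setP/(_ i); rewrite !inE => /negbFE.
  exists delta; split=> [i j ij|s /andP[s0 sM] i]; first exact: sepQ.
  case: (leP t s) => ts.
    by have [|j [_ ? ?]] := netQ s _ i; [rewrite ts|exists j].
  by exists i; [exact: le_trans (ltW ts) (tQ _ (QT _))|rewrite D_refl].
have QT : Q != [set: I]%SET.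
  by apply: contra_eq_neq cQ => ->; rewrite finset.setCT cards0.
have [x [u [xQ u0 ux uQ]]] := @farthest_point Q Q0 QT.
have ut : u <= t.
  have [|j [jQ _ xj]] := netQ t _ x; first by rewrite lexx.
  exact: le_trans (ux _ jQ) xj.
pose delta' i := if i == x then u else delta i.
have delta'Q i : i \in Q -> delta' i = delta i.
  by rewrite /delta'; case: eqP => // ->; rewrite (negbTE xQ).
have delta'x : delta' x = u by rewrite /delta' eqxx.
apply: (IHn (x |: Q)%SET delta' u).
- apply/eqP; rewrite -(eqn_add2l 1) -[X in _ == X]/(n.+1) -cQ.
  rewrite (cardsD1 x (~: Q)) finset.in_setC xQ; apply/eqP; congr (_ + #|pred_of_set _|)%N.
  by apply/setP => i; rewrite !inE negb_or.
- by apply/set0Pn; exists x; rewrite finset.setU11.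
- move=> i; rewrite finset.in_setU1 => /orP[/eqP->|iQ]; first by rewrite delta'x.
  by rewrite delta'Q// (le_trans ut)// tQ.
- move=> i j; rewrite !finset.in_setU1 => /orP[/eqP->|iQ] /orP[/eqP->|jQ] ij.
  + by rewrite eqxx in ij.
  + by rewrite ge_min delta'x ux.
  + by rewrite ge_min delta'x D_sym ux// orbT.
  + by rewrite !delta'Q// sepQ.
- move=> s /andP[us sM] i; case: (leP t s) => ts.
    have [|j [jQ dj ij]] := netQ s _ i; first by rewrite ts.
    by exists j; rewrite finset.in_setU1 jQ orbT delta'Q.
  have [q qQ iq] := uQ i; exists q; rewrite finset.in_setU1 qQ orbT delta'Q//.
  by split=> //; [exact: le_trans (ltW ts) (tQ _ qQ)|exact: le_trans us].
- exact: le_trans tM.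
Qed.

End greedy_net.

(** * The sup distance on [R^d] *)

Section sup_distance.
Context {R : realType} {d : nat}.
Implicit Types (x y z : 'I_d -> R).

Definition ndist x y : R := \big[Num.max/0]_k `|x k - y k|.

Lemma ndist_ge x y k : `|x k - y k| <= ndist x y.
Proof. exact: le_bigmax. Qed.

Lemma ndist_le x y (w : R) : 0 <= w -> (forall k, `|x k - y k| <= w) -> ndist x y <= w.
Proof. by move=> w0 xy; apply/bigmax_leP; split. Qed.

Lemma ndist_ge0 x y : 0 <= ndist x y.
Proof. exact: bigmax_ge_id. Qed.

Lemma ndistC x y : ndist x y = ndist y x.
Proof. by apply: eq_bigr => k _; rewrite distrC. Qed.

Lemma ndistxx x : ndist x x = 0.
Proof.
apply/eqP; rewrite eq_le ndist_ge0 andbT.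
by apply: ndist_le => // k; rewrite subrr normr0.
Qed.

Lemma ndist_triangle y x z : ndist x z <= ndist x y + ndist y z.
Proof.
apply: ndist_le => [|k]; first by rewrite addr_ge0 ?ndist_ge0.
by rewrite (le_trans (ler_distD (y k) _ _))// lerD// ndist_ge.
Qed.

Lemma ndist_eq0 x y : ndist x y = 0 -> x =1 y.
Proof.
move=> xy k; apply/eqP; rewrite -subr_eq0 -normr_le0 -xy; exact: ndist_ge.
Qed.

Lemma ndist_attained x y : (0 < d)%N -> exists k, ndist x y = `|x k - y k|.
Proof.
move=> d0; pose k0 := Ordinal d0.
case: (@arg_maxP _ _ _ k0 xpredT (fun k => `|x k - y k|) isT) => k _ kmax.
exists k; apply/eqP; rewrite eq_le ndist_ge andbT.
by apply: ndist_le => // j; exact: kmax.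
Qed.

Lemma ndist_sqr x y : ndist x y ^+ 2 <= \sum_k (x k - y k) ^+ 2.
Proof.
case: (posnP d) => [d0|d0].
  rewrite (_ : ndist x y = 0) ?expr0n ?sumr_ge0// => [k _|]; first exact: sqr_ge0.
  apply/eqP; rewrite eq_le ndist_ge0 andbT; apply: ndist_le => // -[k kd].
  by exfalso; rewrite d0 in kd.
have [k ->] := ndist_attained x y d0.
rewrite real_normK ?num_real// (bigD1 k)//= lerDl sumr_ge0// => j _.
exact: sqr_ge0.
Qed.

End sup_distance.

(** * Height of the hull of ideal points, and the scales of its witnesses *)

Section convex_hull_height.
Context {R : realType} (d : nat) (I : finType) (pt : I -> 'I_d -> R).
Hypothesis d_gt0 : (0 < d)%N.

(* [(a, h)] lies in every hyperbolic half-space whose boundary at infinity is a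
   sphere and which contains the ideal points [pt i] and the point at
   infinity. *)
Definition above_hull (a : 'I_d -> R) (h : R) := forall (c : 'I_d -> R) (s : R),
  (forall i, s <= \sum_k (pt i k - c k) ^+ 2) -> s <= \sum_k (a k - c k) ^+ 2 + h ^+ 2.

(** Move the center of the sphere from [a] by [rho] along the axis [k]; the term [rho^2] cancels,
    which allows arbitrarily large hemispheres. *)
Lemma above_hull_linear a h k (rho t : R) : above_hull a h ->
  (forall i, t <= \sum_j (pt i j - a j) ^+ 2 + 2 * rho * (pt i k - a k)) -> t <= h ^+ 2.
Proof.
move=> hull tP.
pose c j := if j == k then a k - rho else a j.
have cE x : \sum_j (x j - c j) ^+ 2 =
    \sum_j (x j - a j) ^+ 2 + 2 * rho * (x k - a k) + rho ^+ 2.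
  rewrite (bigD1 k)//= [in RHS](bigD1 k)//= /c eqxx.
  rewrite (eq_bigr (fun j => (x j - a j) ^+ 2)); first by ring.
  by move=> j /negbTE->.
have := hull c (t + rho ^+ 2); rewrite cE big1 => [|j _]; last by rewrite subrr expr0n.
have H : forall i, t + rho ^+ 2 <= \sum_j (pt i j - c j) ^+ 2.
  by move=> i; rewrite cE lerD2r.
by move=> /(_ H); rewrite subrr; lra.
Qed.

(* [i0] is nearest to [a], seen along the axis [k]; [i1] is the nearest point
   outside the cone around that axis. *)
Definition hull_witness (a : 'I_d -> R) (h : R) (k : 'I_d) (b : bool) (i0 i1 : I)
    (s := (-1) ^+ b : R) (r := ndist (pt i0) a) (rr := ndist (pt i1) a) :=
  [/\ s * (pt i0 k - a k) = r, r <= rr,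
      (forall i, ndist (pt i) a < rr -> ndist (pt i) a <= 2 * (s * (pt i k - a k))),
      rr / 4 <= ndist (pt i0) (pt i1) & r * rr <= 4 * h ^+ 2].

Lemma above_hull_witness a h : above_hull a h -> 0 < h -> (0 < #|I|)%N ->
  (forall i, 0 < ndist (pt i) a) -> exists k b i0 i1, hull_witness a h k b i0 i1.
Proof.
move=> hull h0 /card_gt0P[i' _] apos.
case: (@arg_minP _ _ _ i' xpredT (fun i => ndist (pt i) a) isT) => i0 _ i0min.
set r := ndist (pt i0) a in i0min *.
have r0 : 0 < r by exact: apos.
have [k rk] := ndist_attained (pt i0) a d_gt0.
pose b := pt i0 k - a k < 0; pose s : R := (-1) ^+ b.
have sr : s * (pt i0 k - a k) = r.
  rewrite /r rk /s /b; case: ltP => [neg|pos].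
    by rewrite expr1 mulN1r ltr0_norm.
  by rewrite expr0 mul1r ger0_norm.
have s1 x : `|s * x| = `|x| by rewrite normrM normr_sign mul1r.
have cone_le i : `|s * (pt i k - a k)| <= ndist (pt i) a by rewrite s1 ndist_ge.
pose far i := 2 * (s * (pt i k - a k)) < ndist (pt i) a.
have near_cone i : ~~ far i -> r <= 2 * (s * (pt i k - a k)).
  by rewrite -leNgt; apply: le_trans; exact: i0min.
have sq i := ndist_sqr (pt i) a.
case: (pickP far) => [j farj|nofar]; last first.
  (* all points lie in the cone: let the half-space become vertical *)
  exfalso; pose rho := (h ^+ 2 + 1) / r.
  have rho0 : 0 < rho by rewrite divr_gt0// ltr_wpDl// sqr_ge0.
  suff : h ^+ 2 + 1 <= h ^+ 2 by lra.
  apply: (@above_hull_linear a h k (s * rho)) => // i.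
  have := @near_cone i; rewrite nofar => /(_ isT) ri.
  have -> : h ^+ 2 + 1 = rho * r by rewrite /rho mulfVK// gt_eqF.
  have := ler_wpM2l (ltW rho0) ri.
  have := sqr_ge0 (ndist (pt i) a); have := sq i; lra.
case: (@arg_minP _ _ _ j far (fun i => ndist (pt i) a) farj) => i1 fari1 i1min.
set rr := ndist (pt i1) a in i1min.
have rr0 : 0 < rr by exact: apos.
have rrr : r <= rr by exact: i0min.
exists k, b, i0, i1; split=> //.
- move=> i irr; rewrite leNgt; apply/negP => /i1min; rewrite leNgt => /negP; apply.
  exact: irr.
(* The distance is at least [rr - r], and at least [r - rr / 2] because [i1] is outside the cone.
   These add up to [rr / 2], so one of them is at least [rr / 4]. *)
- rewrite -/rr.
  have h1 : rr - r <= ndist (pt i0) (pt i1).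
    have := ndist_triangle (pt i0) (pt i1) a; rewrite -/r -/rr (ndistC (pt i1)).
    by lra.
  have h2 : r - rr / 2 <= ndist (pt i0) (pt i1).
    apply: le_trans (ndist_ge _ _ k); rewrite -s1.
    apply: le_trans (ler_norm _).
    have : 2 * (s * (pt i1 k - a k)) < rr by exact: fari1.
    by lra.
  by lra.
(* Take [rho = s * (rr / 4)]. A point in the cone gains [r * rr / 4] from the linear term; one
   outside has [x >= rr], and [x^2 - x * rr / 2 >= rr^2 / 2]. *)
- rewrite -/r -/rr; suff : r * rr / 4 <= h ^+ 2 by lra.
  apply: (@above_hull_linear a h k (s * (rr / 4))) => // i.
  apply: le_trans (lerD (sq i) (lexx _)).
  set x := ndist (pt i) a; have x0 : 0 <= x by exact: ndist_ge0.
  rewrite [X in _ + X](_ : _ = rr / 2 * (s * (pt i k - a k))); last by field.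
  case: (boolP (far i)) => fi.
    have rx : rr <= x by exact: i1min.
    have := cone_le i; rewrite -/x ler_norml => /andP[xi _].
    have : rr / 2 * (- x) <= rr / 2 * (s * (pt i k - a k)).
      by rewrite ler_wpM2l//; lra.
    by nra.
  have := near_cone _ fi => ri.
  have : rr / 4 * r <= rr / 4 * (2 * (s * (pt i k - a k))).
    by rewrite ler_wpM2l//; lra.
  by have := sqr_ge0 x; lra.
Qed.

(* Nearest points of [a] and [a'] lie in each other's cones, which confines
   both to the tip of the cone. *)
Lemma witness_diameter a a' h h' k b i0 i0' i1 i1' (rho : R) :
  hull_witness a h k b i0 i1 -> hull_witness a' h' k b i0' i1' ->
  ndist (pt i0) a <= rho -> ndist (pt i0') a' <= rho ->
  ndist a a' + rho < ndist (pt i1) a -> ndist a a' + rho < ndist (pt i1') a' ->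
  ndist a' a <= 5 * rho.
Proof.
move=> [s1 _ cone _ _] [s2 _ cone' _ _] r1 r2 R1 R2.
have t1 := ndist_triangle a' (pt i0') a.
have t2 := ndist_triangle a (pt i0) a'.
have t3 := ndist_triangle (pt i0') a' a.
move: (t1) (t2) (t3); rewrite (ndistC a' a) (ndistC a' (pt i0')) => u1 u2 u3.
have c1 : ndist (pt i0') a < ndist (pt i1) a by lra.
have c2 : ndist (pt i0) a' < ndist (pt i1') a' by lra.
have := cone _ c1; have := cone' _ c2.
have := ndist_ge0 (pt i0) a'; have := ndist_ge0 (pt i0') a.
move: s1 s2; set s := _ ^+ _; lra.
Qed.

(** Apply [greedy_net] at one eighth of the distance [D] from [pt i0] to [pt i1]. The points found
    near these two are distinct and at most [5 D / 4] apart, so by separation one of them has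
    [delta] between [D / 8] and [5 D / 4]; and [D] lies between [rr / 4] and [2 rr]. *)
Lemma scale_witness (i' : I) : exists delta : I -> R,
  forall a h k b i0 i1, hull_witness a h k b i0 i1 -> 0 < ndist (pt i0) a ->
  exists j, [/\ 0 < delta j, 2 / 5 * delta j <= ndist (pt i1) a &
                ndist a (pt j) <= 128 * delta j].
Proof.
pose D i j := ndist (pt i) (pt j).
pose M := \sum_i \sum_j D i j.
have DM i j : D i j <= M.
  rewrite /M (bigD1 i)//= (bigD1 j)//= -addrA lerDl addr_ge0// ?sumr_ge0// => i2 _.
    exact: ndist_ge0.
  by rewrite sumr_ge0// => j2 _; exact: ndist_ge0.
have [delta [sep net]] := @greedy_net R I D M (fun i j => ndist_ge0 _ _) DM
  (fun i => ndistxx _) (fun i j => ndistC _ _) i'.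
exists delta => a h k b i0 i1 [_ rR _ RD _] r0.
set r := ndist (pt i0) a in rR r0; set rr := ndist (pt i1) a in rR RD *.
have D0 : 0 < D i0 i1 by rewrite /D; lra.
have D2 : D i0 i1 <= 2 * rr.
  have := ndist_triangle a (pt i0) (pt i1); rewrite (ndistC a) -/r -/rr -/(D i0 i1); lra.
have sM : 0 <= D i0 i1 / 8 <= M by apply/andP; split; have := DM i0 i1; lra.
have [j0 d0 e0] := net _ sM i0; have [j1 d1 e1] := net _ sM i1.
have T1 := ndist_triangle (pt i0) (pt j0) (pt j1).
have T2 := ndist_triangle (pt i1) (pt i0) (pt j1).
have T3 := ndist_triangle (pt j0) (pt i0) (pt i1).
have T4 := ndist_triangle (pt j1) (pt j0) (pt i1).
have T5 := ndist_triangle (pt j0) (pt i0) (pt j1).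
have jj : j0 != j1.
  apply/eqP => E; move: T3 e0 e1; rewrite /D -E (ndistC (pt j0) (pt i1)) in D0 *; lra.
have T6 := ndist_triangle (pt i0) a (pt j0).
have T7 := ndist_triangle (pt i0) a (pt j1).
rewrite (ndistC (pt j0) (pt i0)) (ndistC a (pt i0)) in T1 T6 T7.
rewrite -/r in T6 T7; rewrite /D in D0 D2 e0 e1 d0 d1 RD *.
have := sep _ _ jj; rewrite ge_min => /orP[]; rewrite /D => dj;
  [exists j0|exists j1]; split; lra.
Qed.

End convex_hull_height.

(** * Volume of the hull of ideal points *)

Section hull_volume.
Context {R : realType} (d : nat).
Local Notation hpt := (@hpoint R d.+1).
Hypothesis d_gt0 : (0 < d)%N.

Section one_scale.
Context (N : nat) (I : finType) (pt : I -> 'I_d -> R) (K : set hpt) (j : I) (delta : R).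
Hypothesis N_ge : 1537 <= N.+1%:R :> R.
Hypothesis delta_gt0 : 0 < delta.

(* Points whose nearest and first off-axis ideal points are at the scale [delta]
   around [pt j]. *)
Definition scale_piece : set hpt := [set p | [/\ K p, 0 < p.2 & exists k b i0 i1,
  [/\ hull_witness d I pt (tnth p.1) p.2 k b i0 i1, 0 < ndist (pt i0) (tnth p.1),
      2 / 5 * delta <= ndist (pt i1) (tnth p.1) &
      ndist (tnth p.1) (pt j) <= 128 * delta]]].

(** The cube of radius [128 delta] around [pt j] is cut into cells of side [delta / 6], indexed by
    [beta]. As 256 * 6 = 1536, each coordinate takes 1537 indices, the last one for the right end
    point. *)
Definition tip_piece (beta : {ffun 'I_d -> 'I_N.+1}) (k : 'I_d) (b : bool) (m : nat) :
    set hpt := [set p | [/\ K p, 0 < p.2,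
  (forall l, (beta l : nat)%:R * (delta / 6) <= tnth p.1 l - pt j l + 128 * delta
     < (beta l : nat).+1%:R * (delta / 6)) & exists i0 i1,
  [/\ hull_witness d I pt (tnth p.1) p.2 k b i0 i1,
      2 / 5 * delta <= ndist (pt i1) (tnth p.1),
      ndist (pt i0) (tnth p.1) <= delta / 5 / (4 ^ m)%:R &
      delta / 5 / (4 ^ m.+1)%:R <= ndist (pt i0) (tnth p.1)]]].

Lemma column_witness (p : hpt) (c : 'I_d -> R) (w h : R) :
  ndist c (tnth p.1) <= w -> h <= p.2 ->
  [set q : hpt | box d c w q.1 /\ h <= q.2] p.
Proof.
by move=> cw hp; split=> //= l; rewrite distrC; apply: le_trans cw; exact: ndist_ge.
Qed.

(** By [witness_diameter] the piece lies over one cube of radius [5 rho], at height at least [h0];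
    the ratio of width to height is [30 / 2^m]. *)
Lemma dominated_tip_piece beta k b m :
  dominated d (tip_piece beta k b m) (2 * 30 ^+ d / (2 ^ m)%:R).
Proof.
have arith (x y h : R) : 0 < x * y -> x / 4 * (2 / 5 * y) <= 4 * h ^+ 2 ->
  x * y / 45 <= h ^+ 2 by lra.
have p2 : 0 < (2 ^ m)%:R :> R by rewrite ltr0n expn_gt0.
have v0 : 0 <= 2 * 30 ^+ d / (2 ^ m)%:R :> R by rewrite divr_ge0// ?mulr_ge0 ?exprn_ge0.
have [[q Tq]|T0] := pselect (exists q, tip_piece beta k b m q); last first.
  by apply: dominatedW (dominated_set0 d) => // p Tp; apply: T0; exists p.
have [rho rhoE] : exists rho, rho = delta / 5 / (4 ^ m)%:R by eexists.
(* From [r >= rho / 4] and [rr >= 2 / 5 * delta] follows [p.2^2 >= rho * delta / 40]. The factor 15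
   makes [h0^2] equal to [rho * delta / 45], just below. *)
have [h0 h0E] : exists h0, h0 = delta / 15 / (2 ^ m)%:R by eexists.
have h0_gt0 : 0 < h0 by rewrite h0E !divr_gt0.
have p4 : (4 ^ m)%:R = (2 ^ m)%:R ^+ 2 :> R by rewrite -natrX -expnM mulnC expnM.
have rho0 : 0 < rho by rewrite rhoE p4 !divr_gt0// exprn_gt0.
have rho1 : rho <= delta / 5.
  rewrite rhoE ler_pdivrMr ?p4 ?exprn_gt0// ler_peMr ?divr_ge0 ?(ltW delta_gt0)//.
  by rewrite -natrX ler1n !expn_gt0.
have rho05 : 0 <= 5 * rho by lra.
apply: dominatedW (@dominated_column _ d (tnth q.1) (5 * rho) h0 d_gt0 rho05 h0_gt0).
  move=> p [Kp pp bp [i0 [i1 [W R1 r1 r2]]]].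
  case: Tq => Kq qp bq [i0' [i1' [W' R1' r1' r2']]].
  rewrite -rhoE in r1 r1'.
  (* The cell size suits [witness_diameter]: [delta / 6 + rho <= 11 / 30 * delta < 2 / 5 *
     delta]. *)
  have close : ndist (tnth p.1) (tnth q.1) <= delta / 6.
    apply: ndist_le => [|l]; first by lra.
    have := bp l; have := bq l; rewrite -[(beta l : nat).+1%:R]natr1.
    move: (tnth p.1 l) (tnth q.1 l) (pt j l) (beta l : nat)%:R delta; clear.
    move=> x y z u e /andP[? ?] /andP[? ?]; rewrite ler_norml.
    by apply/andP; split; lra.
  apply: column_witness.
    apply: (@witness_diameter _ _ _ _ _ _ _ _ _ _ _ _ _ _ _ W W') => //;
    move: close rho1 R1 R1' delta_gt0; clear => *; lra.
  have [_ _ _ _ rRh] := W.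
  rewrite -(ler_pXn2r (ltn0Sn 1)) ?nnegrE ?(ltW pp) ?(ltW h0_gt0)//.
  have lo : rho / 4 * (2 / 5 * delta) <= 4 * p.2 ^+ 2.
    apply: le_trans rRh; apply: ler_pM => //.
    - by rewrite divr_ge0// ltW.
    - by rewrite mulr_ge0// ltW.
    - by move: r2; rewrite expnS natrM invfM mulrA mulrAC -rhoE.
  have -> : h0 ^+ 2 = rho * delta / 45.
    by rewrite h0E rhoE p4; field; rewrite gt_eqF.
  exact: arith (mulr_gt0 rho0 delta_gt0) lo.
rewrite -[leRHS]mulrA ler_wpM2l//.
have -> : 2 * (5 * rho) / h0 = 30 / (2 ^ m)%:R.
  by rewrite rhoE h0E p4; field; rewrite !gt_eqF.
rewrite expr_div_n ler_wpM2l ?exprn_ge0// lef_pV2 ?posrE ?exprn_gt0//.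
by apply: ler_eXnr; rewrite ?ler1n ?expn_gt0.
Qed.

(** If the nearest ideal point is at distance at least [delta / 5], the witness forces height at
    least [delta / 8] and one column suffices. Otherwise that distance falls into one of the scales
    [delta / 5 / 4^m]. *)
Lemma scale_piece_sub : scale_piece `<=`
  [set q : hpt | box d (pt j) (128 * delta) q.1 /\ delta / 8 <= q.2] `|`
  \bigcup_(t : {ffun 'I_d -> 'I_N.+1} * ('I_d * bool)) \bigcup_m
     tip_piece t.1 t.2.1 t.2.2 m.
Proof.
have arith (x h : R) : 0 < x * x -> x / 5 * (2 / 5 * x) <= 4 * h ^+ 2 ->
  (x / 8) ^+ 2 <= h ^+ 2 by lra.
move=> p [Kp pp [k [b [i0 [i1 [W r0 R1 pj]]]]]].
set r := ndist (pt i0) _ in r0.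
have [_ _ _ _ rRh] := W.
case: (leP (delta / 5) r) => rd.
  left; apply: column_witness; first by rewrite ndistC.
  rewrite -(ler_pXn2r (ltn0Sn 1)); [|by rewrite nnegrE divr_ge0// ltW
    |by rewrite nnegrE ltW].
  have : delta / 5 * (2 / 5 * delta) <= 4 * p.2 ^+ 2.
    by apply: le_trans rRh; apply: ler_pM => //; rewrite ?mulr_ge0 ?(ltW delta_gt0).
  exact: arith (mulr_gt0 delta_gt0 delta_gt0).
right.
have [m /andP[m1 m2]] : exists m, (4 ^ m)%:R <= delta / 5 / r < (4 ^ m.+1)%:R.
  by apply: geometric_scale => //; rewrite ler_pdivlMr// mul1r ltW.
have pl l : 0 <= (tnth p.1 l - pt j l + 128 * delta) / (delta / 6) < N.+1%:R.
  have := ndist_ge (tnth p.1) (pt j) l => /le_trans/(_ pj).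
  rewrite ler_norml => /andP[? ?].
  have d6 : 0 < delta / 6 by lra.
  apply/andP; split; first by rewrite divr_ge0 ?(ltW d6)//; lra.
  by apply: lt_le_trans N_ge; rewrite ltr_pdivrMr//; lra.
pose beta := [ffun l => inord (Num.truncn
  ((tnth p.1 l - pt j l + 128 * delta) / (delta / 6))) : 'I_N.+1].
exists (beta, (k, b)) => //; exists m => //; split=> //=.
  move=> l; have /andP[l0 l1] := pl l.
  have d6 : 0 < delta / 6 by lra.
  rewrite -ler_pdivlMr// -ltr_pdivrMr// ffunE inordK.
    exact: truncn_itv.
  by rewrite truncn_lt_nat.
exists i0, i1; split=> //.
- by rewrite -/r ler_pdivlMr ?ltr0n ?expn_gt0// mulrC -ler_pdivlMr.
- by rewrite -/r ler_pdivrMr ?ltr0n ?expn_gt0// [leRHS]mulrC -ler_pdivrMr// ltW.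
Qed.

Definition scale_constant : R :=
  2 * 2048 ^+ d + (#|{: {ffun 'I_d -> 'I_N.+1} * ('I_d * bool)}|)%:R * (2 * (2 * 30 ^+ d)).

Lemma dominated_scale_piece : dominated d scale_piece scale_constant.
Proof.
have d8 : 0 < delta / 8 by rewrite divr_gt0.
have d128 : 0 <= 128 * delta by rewrite mulr_ge0 ?(ltW delta_gt0).
have := @dominated_bigcup_fin R d bool (fun b => if b then
    [set q : hpt | box d (pt j) (128 * delta) q.1 /\ delta / 8 <= q.2] else
    \bigcup_(t : {ffun 'I_d -> 'I_N.+1} * ('I_d * bool)) \bigcup_m
       tip_piece t.1 t.2.1 t.2.2 m)
  (fun b => if b then 2 * 2048 ^+ d else
    (#|{: {ffun 'I_d -> 'I_N.+1} * ('I_d * bool)}|)%:R * (2 * (2 * 30 ^+ d))).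
move=> H; apply: dominatedW (H _).
- by move=> p /scale_piece_sub[pl|pr]; [exists true|exists false].
- by rewrite big_bool.
- case.
    apply: dominatedW (@dominated_column _ d (pt j) _ _ d_gt0 d128 d8) => //.
    rewrite (_ : 2 * (128 * delta) / (delta / 8) = 2048)//; field.
    by rewrite gt_eqF.
  apply: dominatedW (@dominated_bigcup_fin R d ({ffun 'I_d -> 'I_N.+1} * ('I_d * bool))%type
    (fun t => \bigcup_m tip_piece t.1 t.2.1 t.2.2 m) (fun=> 2 * (2 * 30 ^+ d)) _) => //.
    by rewrite sumr_const [leRHS]mulr_natl.
  by move=> t; apply: dominated_bigcup_geo => m; exact: dominated_tip_piece.
Qed.

End one_scale.

Lemma dominated_above_hull (N : nat) (I : finType) (pt : I -> 'I_d -> R) (K : set hpt) :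
  1537 <= N.+1%:R :> R ->
  (forall p, K p -> 0 < p.2 /\ above_hull d I pt (tnth p.1) p.2) ->
  dominated d K (#|I|%:R * (scale_constant N)).
Proof.
move=> N_ge KP; have [I0|/card_gt0P[i' _]] := posnP #|I|.
  rewrite I0 mul0r; apply: dominatedW (dominated_set0 d) => // p /KP[_ hull].
  (* Without ideal points every hemisphere is allowed, and this one, centered below [p] and reaching
     higher, excludes [p]. *)
  have := hull (tnth p.1) (p.2 ^+ 2 + 1).
  rewrite big1 => [|k _]; last by rewrite subrr expr0n.
  have nI : I -> False by move=> i; have := fintype0 i; rewrite I0.
  by move=> /(_ (fun i => False_ind _ (nI i))); rewrite add0r gerDl ler10.
have [delta deltaP] := scale_witness d I pt i'.
pose K1 i : set hpt := if 0 < delta i then scale_piece I pt K i (delta i) else set0.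
(* Points straight above an ideal point admit no witness with positive nearest distance; columns of
   width zero show that they are negligible. *)
pose K2 i : set hpt := \bigcup_(m : nat)
  [set q : hpt | box d (pt i) 0 q.1 /\ ((2 ^ m)%:R)^-1 <= q.2].
have sc0 : 0 <= (scale_constant N) by rewrite /scale_constant addr_ge0 ?mulr_ge0 ?exprn_ge0 ?ler0n.
have K1d i : dominated d (K1 i) (scale_constant N).
  rewrite /K1; case: ltP => di; first exact: dominated_scale_piece.
  exact: dominatedW (dominated_set0 d).
have K2d i : dominated d (K2 i) 0.
  rewrite -(mulr0 2); apply: dominated_bigcup_geo => m; rewrite mul0r.
  have p2 : 0 < ((2 ^ m)%:R)^-1 :> R by rewrite invr_gt0 ltr0n expn_gt0.
  apply: dominatedW (@dominated_column _ d (pt i) 0 _ d_gt0 (lexx 0) p2) => //.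
  by rewrite mulr0 mul0r expr0n gtn_eqF// mulr0.
have := @dominated_bigcup_fin R d _ (fun b : I * bool => if b.2 then K1 b.1 else K2 b.1)
  (fun b => if b.2 then (scale_constant N) else 0).
move=> H; apply: dominatedW (H _) => [p Kp||[i []] /=]; [ | |exact: K1d|exact: K2d].
  have [p0 hull] := KP _ Kp.
  have [[i pi]|np] := pselect (exists i, ndist (pt i) (tnth p.1) = 0).
    exists (i, false) => //=.
    have [m m1] : exists m, (p.2)^-1 <= (2 ^ m)%:R.
      exists (Num.truncn (p.2)^-1).+1.
      apply: le_trans (ltW (truncnS_gt _)) _; rewrite ler_nat ltnW//.
      exact: ltn_expl.
    exists m => //; split=> /= [l|].
      by rewrite -(ndist_eq0 _ _ pi) subrr normr0.
    by rewrite -[leRHS]invrK lef_pV2// ?posrE ?invr_gt0// ltr0n expn_gt0.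
  have apos i : 0 < ndist (pt i) (tnth p.1).
    by rewrite lt_neqAle ndist_ge0 andbT eq_sym; apply/eqP => i0; apply: np; exists i.
  have I0 : (0 < #|I|)%N by apply/card_gt0P; exists i'.
  have [k [b [i0 [i1 W]]]] := @above_hull_witness _ _ _ _ d_gt0 _ _ hull p0 I0 apos.
  have [j [dj R1 pj]] := deltaP _ _ _ _ _ _ W (apos _).
  exists (j, true) => //=; rewrite /K1 dj; split=> //.
  by exists k, b, i0, i1.
rewrite -(pair_bigA _ (fun (i : I) (b : bool) => if b then (scale_constant N) else 0)) /=.
rewrite (eq_bigr (fun=> (scale_constant N))) => [|i _]; last by rewrite big_bool /= addr0.
by rewrite sumr_const [leRHS]mulr_natl.
Qed.

End hull_volume.

(** * Packed boxes and the grids of ideal points attached to them *)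

Section reduction_to_ideal_points.
Context {R : realType} (d : nat).
Local Notation hpt := (@hpoint R d.+1).
Local Notation hspace := (@hspace R d.+1).

Definition grid_point (L : nat) (eta a : R) (z : 'I_(2 * L).+1) : R :=
  a + eta * ((z : nat)%:R - L%:R).

(* Rounding [b] to the grid in the direction of [c]. *)
Lemma grid_rounding (L : nat) (eta a b c : R) : 0 < eta ->
  `|b - a| <= eta * (L%:R - 1) ->
  exists z, (grid_point L eta a z - c) ^+ 2 <= (b - c) ^+ 2 + eta ^+ 2.
Proof.
move=> eta0; rewrite ler_norml => /andP[b1 b2].
pose t := (b - a) / eta + L%:R.
have t1 : 1 <= t.
  have : - (L%:R - 1) <= (b - a) / eta by rewrite ler_pdivlMr// mulrC mulrN.
  by rewrite /t; lra.
have t2 : t <= 2 * L%:R - 1.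
  have : (b - a) / eta <= L%:R - 1 by rewrite ler_pdivrMr// mulrC.
  by rewrite /t; lra.
have bt : b = a + eta * (t - L%:R) by rewrite /t; field; rewrite gt_eqF.
have /andP[i1 i2] : (Num.truncn t)%:R <= t < (Num.truncn t).+1%:R.
  by apply: truncn_itv; lra.
set i := Num.truncn t in i1 i2.
have iL : (i.+1 < (2 * L).+1)%N.
  rewrite ltnS -(ler_nat R) natrM -natr1; lra.
rewrite -natr1 in i2.
(* Rounding toward [c] gives the cross term a favorable sign, so the error is at most [eta^2]
   however far [c] is. *)
have sq x y : 0 <= x -> 0 <= y -> y <= eta -> (x - y) ^+ 2 <= x ^+ 2 + eta ^+ 2.
  move=> x0 y0 ye.
  have : y ^+ 2 <= eta ^+ 2 by rewrite lerXn2r// nnegrE// ltW.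
  by have := mulr_ge0 x0 y0; lra.
case: (leP c b) => cb.
  exists (Ordinal (ltnW iL)); rewrite /grid_point /=.
  rewrite [X in X ^+ 2 <= _](_ : _ = (b - c) - eta * (t - i%:R)).
    apply: sq; rewrite ?subr_ge0// ?mulr_ge0 ?subr_ge0 ?(ltW eta0)//.
    by rewrite ler_piMr ?(ltW eta0)//; lra.
  by rewrite [in RHS]bt; ring.
exists (Ordinal iL); rewrite /grid_point /= -natr1 -sqrrN -[(b - c) ^+ 2]sqrrN.
rewrite [X in X ^+ 2 <= _](_ : _ = - (b - c) - eta * (i%:R + 1 - t)).
  apply: sq; rewrite ?oppr_ge0 ?subr_le0 ?(ltW cb)// ?mulr_ge0 ?subr_ge0 ?(ltW eta0)// ?(ltW i2)//.
  by rewrite ler_piMr ?(ltW eta0)//; lra.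
by rewrite [in RHS]bt; ring.
Qed.

Lemma hbox_meet (kappa : R) (x y : hpt) : 0 < kappa <= 1 -> hspace x -> hspace y ->
  hbox d kappa x `&` hbox d kappa y !=set0 ->
  [/\ x.2 <= 2 * y.2, y.2 <= 2 * x.2 &
      forall k, `|tnth y.1 k - tnth x.1 k| <= 3 * x.2].
Proof.
move=> /andP[k0 k1] hx hy [q [[Bx /andP[x1 x2]] [By /andP[y1 y2]]]].
have x0 : 0 < x.2 := hx. have y0 : 0 < y.2 := hy.
have kx : kappa * x.2 <= x.2 by rewrite ler_piMl// ltW.
have ky : kappa * y.2 <= y.2 by rewrite ler_piMl// ltW.
split; [lra|lra|move=> k].
have := Bx k; have := By k; rewrite !ler_norml => /andP[? ?] /andP[? ?].
by apply/andP; split; lra.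
Qed.

(** The finite volume of [U] bounds the number of disjoint boxes, so a largest family exists; a box
    missing all of it could be added. *)
Lemma maximal_disjoint_hboxes (kappa v : R) (A U : set hpt) :
  0 < v -> A `<=` hspace ->
  (forall (k : nat) (x : 'I_k -> hpt), (forall i, A (x i)) ->
     (forall i j, i != j -> hbox d kappa (x i) `&` hbox d kappa (x j) = set0) ->
     ((k%:R * v)%:E <= hvol U)%E) ->
  (hvol U < +oo)%E ->
  exists (k : nat) (x : 'I_k -> hpt), [/\ (forall i, A (x i)),
    ((k%:R * v)%:E <= hvol U)%E &
    forall y, A y -> exists i, hbox d kappa (x i) `&` hbox d kappa y !=set0].
Proof.
move=> v0 Ah vol Ufin.
pose P k := `[< exists x : 'I_k -> hpt, (forall i, A (x i)) /\
  (forall i j, i != j -> hbox d kappa (x i) `&` hbox d kappa (x j) = set0) >].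
have P0 : P 0%N by apply/asboolP; exists (fun i => point); split=> -[].
have volP k : P k -> ((k%:R * v)%:E <= hvol U)%E.
  by move=> /asboolP[x [xA xd]]; exact: vol xA xd.
have [V UV] : exists V : R, hvol U = V%:E.
  exists (fine (hvol U)); rewrite fineK// ge0_fin_numE//.
  by have := volP _ P0; rewrite mul0r.
have Pbound k : P k -> (k <= (Num.truncn (V / v)).+1)%N.
  move=> /volP; rewrite UV lee_fin -ler_pdivlMr// => kV.
  rewrite -(ler_nat R) (le_trans kV)// ltW// truncnS_gt//.
case: (ex_maxnP (ex_intro (fun k => P k) 0%N P0) Pbound) => k Pk kmax.
have /asboolP[x [xA xd]] := Pk.
exists k, x; split=> // [|y Ay]; first exact: volP.
apply: contrapT => nex.
have ydis i : hbox d kappa (x i) `&` hbox d kappa y = set0.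
  by apply/eqP; apply: contrapT => /negP/set0P ne; apply: nex; exists i.
have : P k.+1.
  apply/asboolP; exists (fun i => if unlift ord0 i is Some j then x j else y).
  split=> [i|i j]; first by case: unliftP => [j _|_].
  case: unliftP => [i' ->|->]; case: unliftP => [j' ->|->] ij.
  - by apply: xd; apply: contra ij => /eqP->.
  - exact: ydis.
  - by rewrite setIC; exact: ydis.
  - by rewrite eqxx in ij.
by move=> /kmax; rewrite ltnn.
Qed.

(** Round [p.1] toward the center [c] in each coordinate: the squared distance to [c] grows by at
    most [d * eta^2 <= p.2^2], so the inequality at a grid point passes to [p]. *)
Lemma hextension_above_grid (e kappa : R) (L k : nat) (x : 'I_k -> hpt)
    (A : set hpt) (M := 2 + 2 * expR e) (eta := fun i => (x i).2 / (2 * M * d.+1%:R)) :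
  0 < e -> 0 < kappa <= 1 -> A `<=` hspace -> (forall i, A (x i)) ->
  (2 * M + 3) * (2 * M * d.+1%:R) + 1 <= L%:R ->
  (forall y, A y -> exists i, hbox d kappa (x i) `&` hbox d kappa y !=set0) ->
  forall p, hextension A e p ->
  above_hull d ('I_k * {ffun 'I_d -> 'I_(2 * L).+1})%type
    (fun u l => grid_point L (eta u.1) (tnth (x u.1).1 l) (u.2 l)) (tnth p.1) p.2.
Proof.
move=> e0 k01 Ah xA LM xmax p [y Ay py] c s sP.
have [i yi] := xmax _ Ay.
have hx := Ah _ (xA i); have hy := Ah _ Ay.
have x0 : 0 < (x i).2 := hx. have y0 : 0 < y.2 := hy.
have [xy yx ayx] := hbox_meet _ _ _ k01 hx hy yi.
have [ap hp p0] := hball_bounds _ _ _ _ e0 hy py.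
have M2 : 2 <= M by rewrite /M; have := expR_ge0 e; lra.
rewrite -/M in ap hp; clearbody M.
have dd1 : 1 <= d.+1%:R :> R by rewrite ler1n.
have Md0 : 0 < 2 * M * d.+1%:R by rewrite !mulr_gt0//; lra.
have eta0 : 0 < eta i by rewrite divr_gt0.
have xE : (x i).2 = eta i * (2 * M * d.+1%:R) by rewrite /eta mulfVK// gt_eqF.
have [dd ddE] : exists dd : R, dd = d.+1%:R by eexists.
clearbody eta; rewrite -ddE in dd1 Md0 LM xE.
(* The size of [L] comes from here: [p.1] is within [M * y.2 + 3 * (x i).2 <= (2 M + 3) * (x i).2]
   of the grid center. *)
have near l : `|tnth p.1 l - tnth (x i).1 l| <= eta i * (L%:R - 1).
  apply: (@le_trans _ _ ((2 * M + 3) * (x i).2)).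
    have := ap l; have := ayx l; rewrite !ler_norml => /andP[? ?] /andP[? ?].
    have : M * y.2 <= M * (2 * (x i).2) by rewrite ler_wpM2l//; lra.
    by move=> ?; apply/andP; split; lra.
  rewrite xE mulrCA ler_wpM2l ?(ltW eta0)//; lra.
have [z zP] := choice (fun l =>
  grid_rounding L (eta i) (tnth (x i).1 l) (tnth p.1 l) (c l) eta0 (near l)).
have := sP (i, [ffun l => z l]) => /le_trans; apply.
apply: (@le_trans _ _ (\sum_(l < d) ((tnth p.1 l - c l) ^+ 2 + eta i ^+ 2))).
  by apply: ler_sum => l _; rewrite ffunE; exact: zP.
rewrite big_split /= lerD2l sumr_const card_ord.
have etap : dd * eta i <= p.2.
  have : (2 * M) * (dd * eta i) <= (2 * M) * p.2.
    by apply: (@le_trans _ _ (x i).2); [rewrite xE; lra|lra].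
  by rewrite ler_pM2l//; lra.
apply: (@le_trans _ _ ((dd * eta i) ^+ 2)); last first.
  by rewrite lerXn2r// nnegrE ?(ltW p0)// mulr_ge0 ?(ltW eta0)//; lra.
rewrite -mulr_natl exprMn ler_wpM2r ?sqr_ge0//.
apply: (@le_trans _ _ dd); first by rewrite ddE ler_nat.
by rewrite expr2 ler_peMr//; lra.
Qed.

End reduction_to_ideal_points.

(** * Comparison of both volumes with the number of packed boxes *)

Theorem theorem1p2 (R : realType) (n : nat) (hn : (2 <= n)%N) (e : R)
    (he : 0 < e) :
  exists2 C : R, 0 < C &
    forall A : set (@hpoint R n), hmeasurable A ->
      (hvol (hconv (hextension A e)) <= C%:E * hvol (hextension A e))%E.
Proof.
case: n hn => [//|d] d1; have d0 : (0 < d)%N by [].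
pose kappa : R := Num.min 1 (e / 3) / d.+1%:R.
have min0 : 0 < Num.min 1 (e / 3) by rewrite lt_min ltr01 divr_gt0.
have k0 : 0 < kappa by rewrite divr_gt0.
have k1 : kappa <= 1.
  by rewrite ler_pdivrMr// mul1r (@le_trans _ _ 1) ?ler1n// ge_min lexx.
have k01 : 0 < kappa <= 1 by rewrite k0.
pose v := (2 * kappa / (1 + kappa)) ^+ d * (kappa / (1 + kappa)).
have v0 : 0 < v.
  by rewrite mulr_gt0 ?exprn_gt0 ?divr_gt0 ?mulr_gt0//; lra.
pose M := 2 + 2 * expR e.
have [L LM] : exists L : nat, (2 * M + 3) * (2 * M * d.+1%:R) + 1 <= L%:R.
  by eexists; apply: ltW; exact: truncnS_gt.
have [N N_ge] : exists N : nat, 1537 <= N.+1%:R :> R.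
  by eexists; apply: ltW; exact: truncnS_gt.
pose c0 := ((2 * L).+1 ^ d)%:R * @scale_constant R d N.
have c0_ge0 : 0 <= c0.
  by rewrite /c0 /scale_constant mulr_ge0 ?addr_ge0 ?mulr_ge0 ?exprn_ge0 ?ler0n.
(* With [k] packed boxes the hull has volume at most [k * c0] and [U] at least [k * v]; adding 1
   makes the constant positive. *)
exists (c0 / v + 1); first by rewrite ltr_wpDl// divr_ge0// ltW.
have C0 : 0 < c0 / v + 1 by rewrite ltr_wpDl// divr_ge0// ltW.
move=> A [Ah _]; set U := hextension A e.
have Uh : U `<=` @hspace R d.+1 by move=> p [y _ []].
have vol k (x : 'I_k -> hpoint d.+1) : (forall i, A (x i)) ->
    (forall i j, i != j -> hbox d kappa (x i) `&` hbox d kappa (x j) = set0) ->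
    ((k%:R * v)%:E <= hvol U)%E.
  move=> xA xd; apply: (@hvol_disjoint_hboxes R d kappa k x U) => // i.
    exact: Ah.
  by move=> q xq; exists (x i) => //; apply: hbox_hball xq => //; exact: Ah.
have [Uoo|] := eqVneq (hvol U) +oo%E.
  by rewrite Uoo gt0_muley ?leey// lte_fin.
rewrite -ltey => Ufin.
have [k [x [xA kU xmax]]] := @maximal_disjoint_hboxes R d kappa v A U v0 Ah vol Ufin.
have above := @hextension_above_grid R d e kappa L k x A he k01 Ah xA LM xmax.
set pt := (X in above_hull _ _ X) in above.
apply: (@le_trans _ _ (k%:R * c0)%:E).
  have cK : #|{: 'I_k * {ffun 'I_d -> 'I_(2 * L).+1}}|%:R * @scale_constant R d N = k%:R * c0.
    by rewrite card_prod card_ffun !card_ord natrM -mulrA.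
  rewrite -cK; apply: dominated_hvol; apply: (@dominated_above_hull R d d0 N _ pt _ N_ge).
  (* Half-space bounds valid on [U] pass to its hull, so the hull too lies above the grid points. *)
  have half c s (Us : forall q, U q -> _) := @hconv_halfspace R d U c s Uh Us.
  move=> p Kp; split=> [|c s sP].
    apply: (half (fun=> 0) 0 _ p Kp).1 => q _.
    by rewrite addr_ge0 ?sqr_ge0// sumr_ge0// => l _; exact: sqr_ge0.
  by apply: (half c s _ p Kp).2 => q Uq; exact: above.
apply: (@le_trans _ _ ((c0 / v + 1)%:E * (k%:R * v)%:E)%E); last first.
  by rewrite lee_pmul2l// lte_fin.
rewrite -EFinM lee_fin mulrDl mul1r.
rewrite (_ : c0 / v * (k%:R * v) = k%:R * c0); last by field; rewrite gt_eqF.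
by rewrite lerDl mulr_ge0// ltW.
Qed.
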